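(* Let $\mathcal F$ be an algebraic language with no nullary symbols, $\mathbf I=([m];\mathcal F)$ a finite $\mathcal F$-algebra, and $(\mathbf A_j,\chi_j)$ ($j\in J$, $J\neq\emptyset$) $\mathcal F$-algebras with surjective homomorphisms $\chi_j\colon\mathbf A_j\to\mathbf I$. Let $\mathbf C_j:=\mathfrak C(\mathbf A_j,\chi_j)$ and $D^{(i)}:=\prod_{l\in J}\chi_l^{-1}(i)$ for $i\in[m]$. (1) The map $B\mapsto B^*:=\{((b_j^{(1)},\dots,b_j^{(m)}))_{j\in J}\in\prod_{j\in J}C_j:(b_j^{(i)})_{j\in J}\in B\cap D^{(i)}\text{ for all }i\in[m]\}$ is an order isomorphism from the set of subuniverses $B$ of the fibered product $\prod^{\downdownarrows\mathbf I}_{j\in J}\mathbf A_j$ with $B\cap D^{(i)}\neq\emptyset$ for every $i$, onto the set of nonempty subuniverses of $\prod_{j\in J}\mathbf C_j$. (2) This map preserves intersections and coordinate manipulations (permutation and duplication of coordinates, projection onto subsets of coordinates): for $R_\ell$ ($\ell\in L$), $R$ in its domain and $K\subseteq J$, $(\bigcap_\ell R_\ell)^*=\bigcap_\ell R_\ell^*$ and $(R|_K)^*=R^*|_K$, in the sense that whenever the left side is defined so is the right side and they are equal. (3) Fix elements $d^{(i)}=(d^{(i)}_j)_{j\in J}\in D^{(i)}$ ($i\in[m]$) and define $x\mapsto\tilde x$ on $\prod^{\downdownarrows\mathbf I}_{j}A_j$ by: if $x=(x_j)_j\in D^{(i)}$, then $\tilde x$ is the element of $\prod_jC_j$ whose $j$-th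 component is the column with $i$-th entry $x_j$ and $l$-th entry $d^{(l)}_j$ for $l\neq i$. If $\mathbf B$ is a subalgebra of $\prod^{\downdownarrows\mathbf I}_j\mathbf A_j$ with $d^{(i)}\in B\cap D^{(i)}$ for all $i$, and $G\subseteq B$ generates $\mathbf B$, then $\{\tilde b:b\in G\}$ generates $\mathbf B^*$.
   Context: $[m]=\{1,\dots,m\}$. The fibered product $\prod^{\downdownarrows\mathbf I}_{j\in J}\mathbf A_j$ is the subalgebra of $\prod_j\mathbf A_j$ on $\{(a_j)_j:\chi_j(a_j)=\chi_{j'}(a_{j'})\ \forall j,j'\}=\bigcup_{i\in[m]}D^{(i)}$. For $(\mathbf A,\chi)$ with $E^{(i)}=\chi^{-1}(i)$, $\mathfrak C(\mathbf A,\chi)$ has universe $E^{(1)}\times\dots\times E^{(m)}$ (columns $\mathbf c=(c^{(1)},\dots,c^{(m)})$), an $m$-ary operation $d(\mathbf c_1,\dots,\mathbf c_m)=(c_1^{(1)},\dots,c_m^{(m)})$, and for each $k$-ary $f\in\mathcal F$ and $\mathbf i\in[m]^k$ a $k$-ary operation $\hat f_{\mathbf i}(\mathbf c_1,\dots,\mathbf c_k)$ obtained from $\mathbf c_1$ by replacing its $f^{\mathbf I}(\mathbf i)$-th entry by $f^{\mathbf A}(c_1^{(i_1)},\dots,c_k^{(i_k)})$. *)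

(* Defs.v *)
From mathcomp Require Import all_boot.
From mathcomp Require Import boolp classical_sets functions.

Set Implicit Arguments.
Unset Strict Implicit.
Unset Printing Implicit Defensive.

Local Open Scope classical_set_scope.

Record signature := Signature { symbol :> Type; arity : symbol -> nat }.

(* Carriers may be empty. *)
Record algebra (F : signature) := Algebra {
  carrier :> Type;
  interp : forall f : F, ('I_(arity f) -> carrier) -> carrier }.

Record hom (F : signature) (A B : algebra F) := Hom {
  hom_fun :> A -> B;
  hom_interp : forall (f : F) (x : 'I_(arity f) -> A),
    hom_fun (interp x) = interp (fun k => hom_fun (x k)) }.

Section Subuniverses.
Variables (F : signature) (A : algebra F).

Definition subuniverse (S : set A) : Prop :=
  forall (f : F) (x : 'I_(arity f) -> A), (forall k, S (x k)) -> S (interp x).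

Definition generated (G : set A) : set A :=
  \bigcap_(S in [set S | subuniverse S /\ G `<=` S]) S.

Definition subalgebra (S : set A) (S_sub : subuniverse S) : algebra F :=
  @Algebra F {x : A | S x} (fun f x =>
    exist S (interp (fun k => sval (x k))) (S_sub f _ (fun k => svalP (x k)))).

End Subuniverses.

Definition prod_algebra (F : signature) (J : Type) (A : J -> algebra F) :
    algebra F :=
  @Algebra F (forall j, A j) (fun f x j => interp (fun k => x k j)).

Definition order_isomorphism (T U : Type) (X : set (set T)) (Y : set (set U))
    (phi : set T -> set U) : Prop :=
  set_bij X Y phi /\
  forall P Q, X P -> X Q -> (P `<=` Q <-> phi P `<=` phi Q).

(* The algebra I = ([m]; F); the index set [m] = {1, ..., m} is rendered by
   'I_m = {0, ..., m - 1}. *)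
Definition index_algebra (F : signature) (m : nat)
    (opI : forall f : F, ('I_(arity f) -> 'I_m) -> 'I_m) : algebra F :=
  @Algebra F 'I_m opI.

(* The language of C(A, chi): the m-ary symbol d, and a symbol of the same
   arity k as f for every symbol f and every i in [m]^k. *)
Inductive column_symbol (F : signature) (m : nat) : Type :=
| diag_symbol
| hat_symbol (f : F) (i : 'I_(arity f) -> 'I_m).

Definition column_signature (F : signature) (m : nat) : signature :=
  @Signature (column_symbol F m) (fun s =>
    match s with diag_symbol => m | @hat_symbol _ _ f _ => arity f end).

Section ColumnAlgebra.
Variables (F : signature) (F_pos : forall f : F, 0 < arity f) (m : nat).
Variable opI : forall f : F, ('I_(arity f) -> 'I_m) -> 'I_m.
Variables (A : algebra F) (chi : hom A (index_algebra opI)).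

(* An element of E^(1) x ... x E^(m), where E^(i) is the fiber of chi at i. *)
Record column := Column {
  entry :> 'I_m -> A;
  entryP : forall i, chi (entry i) = i }.

Definition diag_op (c : 'I_m -> column) : column :=
  @Column (fun i => c i i) (fun i => entryP (c i) i).

Lemma hat_subproof (f : F) (i : 'I_(arity f) -> 'I_m)
    (c : 'I_(arity f) -> column) (l : 'I_m) :
  chi (if l == opI i then interp (fun k => c k (i k))
       else c (Ordinal (F_pos f)) l) = l.
Proof.
case: eqP => [->|_]; last exact: entryP.
rewrite hom_interp /=; congr opI; apply/funext => k; exact: entryP.
Qed.

(* Ordinal (F_pos f) is the first argument position of f. *)
Definition hat_op (f : F) (i : 'I_(arity f) -> 'I_m)
    (c : 'I_(arity f) -> column) : column :=
  @Column (fun l => if l == opI i then interp (fun k => c k (i k))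
                    else c (Ordinal (F_pos f)) l)
          (hat_subproof i c).

Definition column_algebra : algebra (column_signature F m) :=
  @Algebra (column_signature F m) column (fun s =>
    match s return ('I_(@arity (column_signature F m) s) -> column) -> column
    with
    | diag_symbol => diag_op
    | @hat_symbol _ _ f i => @hat_op f i
    end).

End ColumnAlgebra.

Section FiberedProduct.
Variables (F : signature) (F_pos : forall f : F, 0 < arity f) (m : nat).
Variable opI : forall f : F, ('I_(arity f) -> 'I_m) -> 'I_m.
Variables (J : Type) (A : J -> algebra F).
Variable chi : forall j, hom (A j) (index_algebra opI).

Definition fibered_universe : set (prod_algebra A) :=
  [set a | forall j j', chi j (a j) = chi j' (a j')].

Lemma fibered_subuniverse : subuniverse fibered_universe.
Proof.
move=> f x xP j j'; rewrite !hom_interp; congr interp.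
by apply/funext => k; exact: xP.
Qed.

Definition fibered_product : algebra F := subalgebra fibered_subuniverse.

Definition fiber (i : 'I_m) : set fibered_product :=
  [set x | forall l, chi l (sval x l) = i].

Definition full_subuniverses : set (set fibered_product) :=
  [set B | subuniverse B /\ forall i, B `&` fiber i !=set0].

Definition column_product : algebra (column_signature F m) :=
  prod_algebra (fun j => column_algebra F_pos (chi j)).

Definition nonempty_subuniverses : set (set column_product) :=
  [set S | subuniverse S /\ S !=set0].

Lemma slice_subproof (b : column_product) (i : 'I_m) :
  fibered_universe (fun j => b j i).
Proof. by move=> j j'; rewrite !entryP. Qed.

Definition slice (b : column_product) (i : 'I_m) : fibered_product :=
  exist fibered_universe (fun j => b j i) (slice_subproof b i).

Definition star (B : set fibered_product) : set column_product :=
  [set b | forall i, (B `&` fiber i) (slice b i)].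

Section Tilde.
Variables (d : 'I_m -> fibered_product) (dP : forall i, fiber i (d i)).

Lemma tilde_subproof (x : fibered_product) (j : J) (l : 'I_m) :
  chi j (if l == chi j (sval x j) then sval x j else sval (d l) j) = l.
Proof. by case: eqP => [->//|_]; exact: dP. Qed.

(* If x lies in fiber i then chi j (x j) = i for every j, so the entry of
   index i of each component is x j. *)
Definition tilde (x : fibered_product) : column_product :=
  fun j => Column (tilde_subproof x j).

End Tilde.

End FiberedProduct.

Arguments full_subuniverses {F m opI J A} chi.
Arguments nonempty_subuniverses {F} F_pos {m opI J A} chi.
Arguments star {F} F_pos {m opI J A chi} B.

(* Manipulation of coordinates along s : K -> J, sending (x_j)_j to
   (x_(s k))_k: a permutation of coordinates for s bijective, a duplication for
   s not injective, the projection onto K for s the inclusion of a subset. *)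
Section Reindexing.
Variables (F : signature) (F_pos : forall f : F, 0 < arity f) (m : nat).
Variable opI : forall f : F, ('I_(arity f) -> 'I_m) -> 'I_m.
Variables (J : Type) (A : J -> algebra F).
Variable chi : forall j, hom (A j) (index_algebra opI).
Variables (K : Type) (s : K -> J).

Definition reindex_fibered (x : fibered_product chi) :
    fibered_product (fun k => chi (s k)) :=
  exist (fibered_universe (fun k => chi (s k))) (fun k => sval x (s k))
        (fun k k' => svalP x (s k) (s k')).

Definition reindex_column (b : column_product F_pos chi) :
    column_product F_pos (fun k => chi (s k)) :=
  fun k => b (s k).

End Reindexing.

Arguments reindex_fibered {F m opI J A chi K} s x.
Arguments reindex_column {F F_pos m opI J A chi K} s b.

(* Main.v *)
(** A subuniverse of the column product is closed under the operation [d], so it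
    is determined by its sets of [i]-th slices, which can be chosen
    independently of each other; the operations of the column algebra then say
    exactly that the union of these sets is closed under the operations of the
    fibered product. For (3), if a subuniverse contains every [tilde g] then its
    set of slices is a subuniverse containing every [g]. *)

Require Import Defs.
From mathcomp Require Import all_boot.
From mathcomp Require Import boolp classical_sets functions.

Set Implicit Arguments.
Unset Strict Implicit.
Unset Printing Implicit Defensive.

Local Open Scope classical_set_scope.

Section Slices.
Variables (F : signature) (F_pos : forall f : F, 0 < arity f) (m : nat).
Variable opI : forall f : F, ('I_(arity f) -> 'I_m) -> 'I_m.

Lemma column_eq (A : algebra F) (chi : hom A (index_algebra opI))
  (b c : column chi) : (forall i, b i = c i) -> b = c.
Proof.
case: b c => [b bP] [c cP] /= bc.
have {}bc : b = c by apply/funext.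
by subst c; rewrite (Prop_irrelevance bP cP).
Qed.

Lemma fibered_eq (J : Type) (A : J -> algebra F)
  (chi : forall j, hom (A j) (index_algebra opI)) (x y : fibered_product chi) :
  (forall j, sval x j = sval y j) -> x = y.
Proof.
move=> xy; apply: eq_sig_hprop => [a|]; first exact: Prop_irrelevance.
exact: functional_extensionality_dep.
Qed.

Variables (J : Type) (A : J -> algebra F).
Variable chi : forall j, hom (A j) (index_algebra opI).

Implicit Types (B : set (fibered_product chi)).
Implicit Types (S : set (column_product F_pos chi)).

Lemma fiber_slice (b : column_product F_pos chi) (i : 'I_m) :
  fiber i (slice b i).
Proof. by move=> l; exact: entryP. Qed.

Lemma fiber_chi (x : fibered_product chi) (j : J) : fiber (chi j (sval x j)) x.
Proof. by move=> l; exact: (svalP x l j). Qed.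

(** Any one coordinate determines the index; over an empty [J] every fiber would be the whole
    product. *)
Lemma fiber_uniq (x : fibered_product chi) (i i' : 'I_m) :
  inhabited J -> fiber i x -> fiber i' x -> i = i'.
Proof. by move=> [j] xi xi'; rewrite -(xi j) (xi' j). Qed.

Lemma slice_eq (b c : column_product F_pos chi) :
  (forall i, slice b i = slice c i) -> b = c.
Proof.
move=> bc; apply: functional_extensionality_dep => j; apply: column_eq => i.
by rewrite -[b j i]/(sval (slice b i) j) bc.
Qed.

(** Inverse of slicing: one point chosen freely in each fiber gives an element of the column
    product. *)
Definition of_slices (x : 'I_m -> fibered_product chi)
    (xP : forall i, fiber i (x i)) : column_product F_pos chi :=
  fun j => Column (fun i => xP i j).

Lemma slice_of_slices (x : 'I_m -> fibered_product chi)
  (xP : forall i, fiber i (x i)) (i : 'I_m) : slice (of_slices xP) i = x i.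
Proof. exact: fibered_eq. Qed.

Lemma slice_diag (b : 'I_m -> column_product F_pos chi) (i : 'I_m) :
  slice (@interp _ (column_product F_pos chi) (diag_symbol F m) b) i =
  slice (b i) i.
Proof. exact: fibered_eq. Qed.

Lemma slice_hat (f : F) (i : 'I_(arity f) -> 'I_m)
  (b : 'I_(arity f) -> column_product F_pos chi) (l : 'I_m) :
  slice (@interp _ (column_product F_pos chi) (hat_symbol i) b) l =
  if l == opI i then interp (fun k => slice (b k) (i k))
  else slice (b (Ordinal (F_pos f))) l.
Proof. by apply: fibered_eq => j /=; case: ifP. Qed.

Lemma starP B (b : column_product F_pos chi) :
  star F_pos B b <-> forall i, B (slice b i).
Proof.
split=> [bB i|bB i]; first by case: (bB i).
by split; [exact: bB|exact: fiber_slice].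
Qed.

Lemma star_subset B B' : B `<=` B' -> star F_pos B `<=` star F_pos B'.
Proof. by move=> BB' b /starP bB; apply/starP => i; exact/BB'/bB. Qed.

(** Each slice of a result is either a slice of an argument or some [f] applied to slices of the
    arguments. *)
Lemma star_subuniverse B : subuniverse B -> subuniverse (star F_pos B).
Proof.
move=> Bsub [|f i] b bB; apply/starP => l.
  by rewrite slice_diag; case: (bB l l).
rewrite slice_hat; case: ifP => _; last by case: (bB (Ordinal (F_pos f)) l).
by apply: Bsub => k; case: (bB k (i k)).
Qed.

Lemma star_nonempty B :
  (forall i, B `&` fiber i !=set0) -> star F_pos B !=set0.
Proof.
move=> /choice[x xP]; exists (of_slices (fun i => (xP i).2)).
by apply/starP => i; rewrite slice_of_slices; case: (xP i).
Qed.

Lemma star_full B : full_subuniverses chi B ->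
  nonempty_subuniverses F_pos chi (star F_pos B).
Proof.
by case=> Bsub B0; split; [exact: star_subuniverse|exact: star_nonempty].
Qed.

Lemma star_subset_inv B B' : inhabited J ->
  (forall i, B `&` fiber i !=set0) ->
  star F_pos B `<=` star F_pos B' -> B `<=` B'.
Proof.
move=> [j] /choice[y yP] BB' x Bx; pose i := chi j (sval x j).
(* Put [x] in the slot of its own fiber and complete it by points of [B] from the other fibers;
   slice [i] then recovers [x]. *)
pose z l := if l == i then x else y l.
have zP l : fiber l (z l).
  by rewrite /z; case: eqP => [->|_]; [exact: fiber_chi|case: (yP l)].
have /BB'/starP/(_ i) : star F_pos B (of_slices zP).
  apply/starP => l; rewrite slice_of_slices /z.
  by case: eqP => // _; case: (yP l).
by rewrite slice_of_slices /z eqxx.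
Qed.

(** The candidate for the inverse image of [S] under [star]. *)
Definition slices S : set (fibered_product chi) :=
  [set x | exists i b, S b /\ slice b i = x].

Lemma slices_subuniverse S : subuniverse S -> subuniverse (slices S).
Proof.
move=> Ssub f x /choice[i /choice[b bP]].
(* The hat operation whose index tuple records where the arguments were sliced carries the value of
   [f] in slot [opI i]. *)
exists (opI i); exists (@interp _ (column_product F_pos chi) (hat_symbol i) b).
split; first by apply: Ssub => k; case: (bP k).
rewrite slice_hat eqxx; congr interp.
by apply: functional_extensionality_dep => k; case: (bP k).
Qed.

(** The slices of [b] may come from different members of [S]; the diagonal operation glues these
    members into [b]. *)
Lemma star_slices S : inhabited J -> subuniverse S ->
  star F_pos (slices S) = S.
Proof.
move=> J0 Ssub; apply/seteqP; split=> [b /starP/choice[i bP]|b Sb]; last first.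
  by apply/starP => i; exists i, b; split.
have /choice[c cP] l : exists c, S c /\ slice c l = slice b l.
  have [c [Sc cb]] := bP l; exists c; split=> //.
  (* A slice taken at [i l] that lies in fiber [l] forces [i l = l]. *)
  have cl : fiber l (slice c (i l)) by rewrite cb; exact: fiber_slice.
  by rewrite -{1}(fiber_uniq J0 (fiber_slice c (i l)) cl).
have -> : b = @interp _ (column_product F_pos chi) (diag_symbol F m) c.
  by apply: slice_eq => l; rewrite slice_diag; case: (cP l).
by apply: Ssub => l; case: (cP l).
Qed.

Lemma slices_full S : nonempty_subuniverses F_pos chi S ->
  full_subuniverses chi (slices S).
Proof.
move=> [Ssub [b Sb]]; split=> [|i]; first exact: slices_subuniverse.
by exists (slice b i); split; [exists i, b; split|exact: fiber_slice].
Qed.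

Lemma star_order_isomorphism : inhabited J ->
  order_isomorphism (full_subuniverses chi) (nonempty_subuniverses F_pos chi)
    (star F_pos (chi := chi)).
Proof.
move=> J0; split; last first.
  move=> B B' [_ B0] _; split; first exact: star_subset.
  exact: star_subset_inv.
split; first by move=> B; exact: star_full.
  (* Injectivity is order reflection used in both directions. *)
  move=> B B' /set_mem[_ B0] /set_mem[_ B'0] BB'.
  by apply/seteqP; split; apply: star_subset_inv => //; rewrite BB'.
move=> S SP; exists (slices S); first exact: slices_full.
by apply: star_slices => //; case: SP.
Qed.

Lemma star_bigcap (L : Type) (R : L -> set (fibered_product chi)) :
  star F_pos (\bigcap_l R l) = \bigcap_l star F_pos (R l).
Proof.
apply/seteqP; split=> [b /starP bR l _|b bR].
  by apply/starP => i; exact: bR.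
by apply/starP => i l _; case: (bR l Logic.I i).
Qed.

(** An arbitrary [s] covers all coordinate manipulations at once. For the inclusion from left to
    right, preimages in [B] of the slices of [b] are glued into one preimage of [b]; this requires
    the preimage of slice [i] to lie in fiber [i]. *)
Lemma star_reindex (K : Type) (s : K -> J) B :
  (forall i, B `&` fiber i !=set0) ->
  star F_pos (reindex_fibered s @` B) = reindex_column s @` star F_pos B.
Proof.
move=> B0; apply/seteqP; split=> [b bB|_ [b /starP bB <-] i]; last first.
  split; last by move=> k; exact: entryP.
  by exists (slice b i); [exact: bB|exact: fibered_eq].
have /choice[x xP] i : exists x,
    [/\ B x, fiber i x & reindex_fibered s x = slice b i].
  have [[x Bx xb] _] := bB i.
  have [[k]|K0] := pselect (inhabited K).
    exists x; split=> //.
    (* A coordinate [k] that survives the reindexing reveals the fiber of [x]. *)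
    have -> : i = chi (s k) (sval x (s k)).
      rewrite -[RHS]/(chi (s k) (sval (reindex_fibered s x) k)) xb.
      by rewrite /= entryP.
    exact: fiber_chi.
  (* Over no coordinates, all elements of B have the same image. *)
  have [y [By yi]] := B0 i; exists y; split=> //.
  by apply: fibered_eq => k; case: K0.
have xi i : fiber i (x i) by case: (xP i).
exists (of_slices xi).
  by apply/starP => i; rewrite slice_of_slices; case: (xP i).
apply: functional_extensionality_dep => k; apply: column_eq => i.
have [_ _ e] := xP i.
by rewrite -[RHS]/(sval (slice b i) k) -e.
Qed.

Section Tilde.
Variables (d : 'I_m -> fibered_product chi) (dP : forall i, fiber i (d i)).

Lemma slice_tilde (x : fibered_product chi) (i : 'I_m) :
  fiber i x -> slice (tilde F_pos dP x) i = x.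
Proof. by move=> xi; apply: fibered_eq => j /=; rewrite xi eqxx. Qed.

Lemma slice_tilde_neq (x : fibered_product chi) (i l : 'I_m) :
  fiber i x -> l != i -> slice (tilde F_pos dP x) l = d l.
Proof.
by move=> xi /negbTE li; apply: fibered_eq => j /=; rewrite xi li.
Qed.

Lemma star_tilde B (x : fibered_product chi) : inhabited J ->
  (forall i, B (d i)) -> B x -> star F_pos B (tilde F_pos dP x).
Proof.
move=> [j] Bd Bx; apply/starP => l; have xi := fiber_chi x j.
have [->|li] := eqVneq l (chi j (sval x j)).
  by rewrite slice_tilde.
by rewrite (slice_tilde_neq xi li).
Qed.

Lemma generated_tilde B (G : set (fibered_product chi)) : inhabited J ->
  subuniverse B -> (forall i, B (d i)) -> generated G = B ->
  generated (tilde F_pos dP @` G) = star F_pos B.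
Proof.
move=> J0 Bsub Bd GB; have GsubB : G `<=` B.
  by rewrite -GB => x Gx S [_]; exact.
apply/seteqP; split=> [b|b bB S [Ssub GS]].
  apply; split; first exact: star_subuniverse.
  by move=> _ [x Gx <-]; apply: star_tilde => //; exact: GsubB.
(* As [S] is the star of [slices S], it suffices that the subuniverse [slices S] contains the
   generators of [B]. *)
rewrite -(star_slices J0 Ssub); apply: star_subset bB.
rewrite -GB => x; apply; split; first exact: slices_subuniverse.
move=> g Gg; have [j] := J0; exists (chi j (sval g j)), (tilde F_pos dP g).
split; first by apply: GS; exists g.
exact: slice_tilde (fiber_chi g j).
Qed.

End Tilde.
End Slices.

Theorem theorem3p1
    (F : signature) (F_pos : forall f : F, 0 < arity f)
    (m : nat) (opI : forall f : F, ('I_(arity f) -> 'I_m) -> 'I_m)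
    (J : Type) (J_nonempty : inhabited J)
    (A : J -> algebra F) (chi : forall j, hom (A j) (index_algebra opI))
    (chi_surj : forall j, set_surj [set: A j] [set: 'I_m] (chi j)) :
  (* (1) *)
  order_isomorphism (full_subuniverses chi) (nonempty_subuniverses F_pos chi)
    (star F_pos (chi := chi)) /\
  (* (2), intersections *)
  (forall (L : Type) (R : L -> set (fibered_product chi)),
    (forall l, full_subuniverses chi (R l)) ->
    full_subuniverses chi (\bigcap_l R l) ->
    nonempty_subuniverses F_pos chi (\bigcap_l star F_pos (R l)) /\
    star F_pos (\bigcap_l R l) = \bigcap_l star F_pos (R l)) /\
  (* (2), permutation and duplication of coordinates *)
  (forall (K : Type) (s : K -> J) (R : set (fibered_product chi)),
    full_subuniverses chi R ->
    full_subuniverses (fun k => chi (s k)) (reindex_fibered s @` R) ->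
    nonempty_subuniverses F_pos (fun k => chi (s k))
      (reindex_column s @` star F_pos R) /\
    star F_pos (reindex_fibered s @` R) = reindex_column s @` star F_pos R) /\
  (* (2), projection onto a subset of the coordinates *)
  (forall (K : set J) (R : set (fibered_product chi)),
    let incl : {j : J | K j} -> J := fun k => sval k in
    full_subuniverses chi R ->
    full_subuniverses (fun k => chi (incl k)) (reindex_fibered incl @` R) ->
    nonempty_subuniverses F_pos (fun k => chi (incl k))
      (reindex_column incl @` star F_pos R) /\
    star F_pos (reindex_fibered incl @` R)
      = reindex_column incl @` star F_pos R) /\
  (* (3) *)
  (forall (d : 'I_m -> fibered_product chi) (dP : forall i, fiber i (d i))
      (B G : set (fibered_product chi)),
    subuniverse B ->
    (forall i, (B `&` fiber i) (d i)) ->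
    G `<=` B ->
    generated G = B ->
    generated (tilde F_pos dP @` G) = star F_pos B).
Proof.
split; [exact: star_order_isomorphism|split; [|split; [|split]]].
(* Once the right side is rewritten as a star, it is defined by [star_full]. *)
- by move=> L R _ RP; rewrite -star_bigcap; split=> //; exact: star_full.
- move=> K s R [_ R0] RP; rewrite -star_reindex //; split=> //.
  exact: star_full.
- move=> K R incl [_ R0] RP; rewrite -star_reindex //; split=> //.
  exact: star_full.
- move=> d dP B G Bsub Bd _; apply: generated_tilde => // i.
  by case: (Bd i).
Qed.
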